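(* Let $\mathbb{F}$ be a field, $d\in\mathbb{N}$, and $Z=\{z_1,\ldots,z_m\}$ a set of noncommuting variables. Let $g\in\mathbb{F}\langle Z\rangle$ be a homogeneous polynomial of degree $d$ computed by an algebraic branching program $P$ with $S$ vertices. Then there exist matrices $A_1,\ldots,A_m\in M_S(\mathbb{F})$ such that for every homogeneous polynomial $f\in\mathbb{F}\langle Z\rangle$ of degree $d$, $$f\circ g = f(A_1z_1,A_2z_2,\ldots,A_mz_m)(1,S).$$ Moreover, given $P$, the matrices $A_1,\ldots,A_m$ can be computed in time polynomial in the size of the description of $P$.
   Context: $\mathbb{F}\langle Z\rangle$ denotes the ring of noncommutative polynomials over $\mathbb{F}$ in the variables $Z$; for $f\in\mathbb{F}\langle Z\rangle$ and a monomial $w$, $f(w)$ denotes the coefficient of $w$ in $f$. The Hadamard product $f\circ g$ is the unique polynomial $h\in\mathbb{F}\langle Z\rangle$ with $h(w)=f(w)g(w)$ for every monomial $w$. For matrices $A_i\in M_S(\mathbb{F})$, $A_iz_i$ is viewed as an element of $M_S(\mathbb{F}\langle Z\rangle)$ (scalar matrices commute with the variables), $f(A_1z_1,\ldots,A_mz_m)\in M_S(\mathbb{F}\langle Z\rangle)$ is obtained by substituting $A_iz_i$ for $z_i$, and $M(1,S)$ denotes the $(1,S)$ entry of a matrix $M$. An algebraic branching program (ABP) is a directed acyclic graph whose vertices are partitioned into levels $0,1,\ldots,d$, with a unique vertex (the source) at level $0$ and a unique vertex (the sink) at level $d$, in which edges go only from level $i$ to level $i+1$, and each edge is labelled by a homogeneous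 linear form in the variables. For a source-to-sink path with edge labels $\ell_1,\ldots,\ell_d$ (in order), its polynomial is the ordered product $\ell_1\ell_2\cdots\ell_d$; the ABP computes the sum of these over all source-to-sink paths. Its size is its number of vertices. *)

(* Defs.v *)
From HB Require Import structures.
From mathcomp Require Import all_boot all_order all_algebra.
From mathcomp Require Import finmap.
From mathcomp Require Export monalg.

Set Implicit Arguments.
Unset Strict Implicit.
Unset Printing Implicit Defensive.

Import GRing.Theory.

Local Open Scope ring_scope.

(** * Noncommutative polynomials *)

(* F<z_1,...,z_m> as the algebra of the free monoid {fmonom 'I_m};
   f@_w is the coefficient of the word w in f. *)
Definition ncpoly (F : fieldType) (m : nat) := {malg F[{fmonom 'I_m}]}.

Definition ncvar (F : fieldType) (m : nat) (i : 'I_m) : ncpoly F m := << fmu i >>.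

Definition nchomog (F : fieldType) (m d : nat) (f : ncpoly F m) : Prop :=
  forall w : {fmonom 'I_m}, f@_w != 0 -> fdeg w = d.

Definition hadamard (F : fieldType) (m : nat) (f g : ncpoly F m) : ncpoly F m :=
  [malg w in msupp f => f@_w * g@_w].

Lemma hadamardE (F : fieldType) (m : nat) (f g : ncpoly F m) (w : {fmonom 'I_m}) :
  (hadamard f g)@_w = f@_w * g@_w.
Proof.
rewrite [LHS]fsfunE; case: ifPn => // wf.
by rewrite [X in X * _]mcoeff_outdom ?mul0r.
Qed.

(* f(B_1,...,B_m) for matrices B_i over F<Z>; a scalar c becomes c times the
   identity matrix. *)
Definition ncsubst (F : fieldType) (m n : nat)
    (B : 'I_m -> 'M[ncpoly F m]_n.+1) (f : ncpoly F m) : 'M[ncpoly F m]_n.+1 :=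
  mmap (fun c : F => (c%:MP : ncpoly F m)%:M)
       (fun w : {fmonom 'I_m} => \prod_(i <- (w : seq 'I_m)) B i) f.

Definition mxvar (F : fieldType) (m n : nat) (A : 'I_m -> 'M[F]_n.+1) (i : 'I_m) :
    'M[ncpoly F m]_n.+1 :=
  map_mx (fun a : F => a *: ncvar F i) (A i).

(** * Algebraic branching programs *)

(* An ABP in m variables with vertex set 'I_S.  [abp_edge u v] is [None] if
   there is no edge from u to v, and [Some l] if there is one, labelled by the
   linear form \sum_i (l i) z_i.  Acyclicity follows from [abp_edge_level]. *)
Record abp (F : fieldType) (m S : nat) := Abp {
  abp_depth : nat;
  abp_level : 'I_S -> nat;
  abp_source : 'I_S;
  abp_sink : 'I_S;
  abp_edge : 'I_S -> 'I_S -> option {ffun 'I_m -> F};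
  abp_level_le : forall v, (abp_level v <= abp_depth)%N;
  abp_level_source : forall v, (abp_level v == 0%N) = (v == abp_source);
  abp_level_sink : forall v, (abp_level v == abp_depth) = (v == abp_sink);
  abp_edge_level : forall u v, isSome (abp_edge u v) ->
    abp_level v = (abp_level u).+1
}.

Section AbpSemantics.
Variables (F : fieldType) (m S : nat) (P : abp F m S).

Definition abp_rel : rel 'I_S := fun u v => isSome (abp_edge P u v).

Definition abp_label (u v : 'I_S) : ncpoly F m :=
  if abp_edge P u v is Some l then \sum_i l i *: ncvar F i else 0.

(* A path is given by the list p of its vertices other than the source. *)
Definition abp_path (p : seq 'I_S) : bool :=
  path abp_rel (abp_source P) p && (last (abp_source P) p == abp_sink P).

Lemma abp_path_size (p : seq 'I_S) : abp_path p -> size p = abp_depth P.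
Proof.
case/andP=> Pp /eqP lastp.
have levE u q : path abp_rel u q ->
    abp_level P (last u q) = (abp_level P u + size q)%N.
  elim: q u => [|v q IHq] u /=; first by rewrite addn0.
  by case/andP=> /abp_edge_level uv /IHq ->; rewrite uv addSnnS.
have := levE _ _ Pp; rewrite lastp.
have /eqP -> : abp_level P (abp_sink P) == abp_depth P by rewrite abp_level_sink.
by have /eqP -> : abp_level P (abp_source P) == 0%N; rewrite ?abp_level_source.
Qed.

(* By [abp_path_size], tuples of length [abp_depth P] account for all the
   source-to-sink paths. *)
Definition abp_poly : ncpoly F m :=
  \sum_(p : (abp_depth P).-tuple 'I_S | abp_path p)
    \prod_(l <- pairmap abp_label (abp_source P) p) l.

End AbpSemantics.

(** * Random access machines over a field, with logarithmic cost *)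

(* A memory cell holds a natural number or a field element.  The memory is a
   family of banks, each an infinite array of cells: M b i is cell i of bank b.
   Programs are structured (while programs) over expressions that read memory
   at computed addresses. *)
Inductive value (F : Type) := Num of nat | Elt of F.
Arguments Num {F} n.

Definition memory (F : Type) := nat -> nat -> value F.

Inductive binop := OpAdd | OpSub | OpMul.

Inductive expr (F : Type) :=
| ECst of value F
| EGet of nat & expr F (* EGet b e : the cell of bank b at address e *)
| EBin of binop & expr F & expr F
| EInv of expr F.

Inductive cmd (F : Type) :=
| CSkip
| CSet of nat & expr F & expr F (* CSet b e e' : cell e of bank b := e' *)
| CSeq of cmd F & cmd F
| CIf of expr F & cmd F & cmd F
| CWhile of expr F & cmd F.
Arguments CSkip {F}.

Section Machine.
Variable F : fieldType.

(* Representation length of a field element: for instance its bit length for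
   F = rat, or a constant for the algebraic (unit cost) model. *)
Variable esize : F -> nat.

Definition vsize (v : value F) : nat :=
  match v with
  | Num n => (trunc_log 2 n).+1
  | Elt x => (esize x).+1
  end.

Definition wsize (w : seq (value F)) : nat := \sum_(v <- w) vsize v.

Definition address (v : value F) : nat := if v is Num n then n else 0%N.

Definition truth (v : value F) : bool :=
  match v with Num n => n != 0%N | Elt x => x != 0 end.

(* Subtraction of natural numbers is truncated; ill-kinded operations yield
   [Num 0]. *)
Definition binop_val (o : binop) (v1 v2 : value F) : value F :=
  match v1, v2 with
  | Num a, Num b => Num match o with
                        | OpAdd => (a + b)%N
                        | OpSub => (a - b)%N
                        | OpMul => (a * b)%N
                        end
  | Elt x, Elt y => Elt match o with
                        | OpAdd => x + y
                        | OpSub => x - y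
                        | OpMul => x * y
                        end
  | _, _ => Num 0
  end.

Definition inv_val (v : value F) : value F :=
  if v is Elt x then Elt x^-1 else Num 0.

Fixpoint eval (M : memory F) (e : expr F) : value F :=
  match e with
  | ECst v => v
  | EGet b e1 => M b (address (eval M e1))
  | EBin o e1 e2 => binop_val o (eval M e1) (eval M e2)
  | EInv e1 => inv_val (eval M e1)
  end.

(* Every value produced, addresses included, is charged its size, which is
   always positive. *)
Fixpoint ecost (M : memory F) (e : expr F) : nat :=
  (vsize (eval M e) +
   match e with
   | ECst _ => 0
   | EGet _ e1 => ecost M e1
   | EBin _ e1 e2 => ecost M e1 + ecost M e2
   | EInv e1 => ecost M e1
   end)%N.

Definition update (M : memory F) (b i : nat) (v : value F) : memory F :=
  fun b' i' => if (b' == b) && (i' == i) then v else M b' i'.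

(* exec M c t M' : started in memory M, c halts in memory M' at cost t. *)
Inductive exec : memory F -> cmd F -> nat -> memory F -> Prop :=
| ExecSkip M : exec M CSkip 1 M
| ExecSet M b e e' :
    exec M (CSet b e e') (ecost M e + ecost M e').+1
      (update M b (address (eval M e)) (eval M e'))
| ExecSeq M1 M2 M3 c c' t t' :
    exec M1 c t M2 -> exec M2 c' t' M3 ->
    exec M1 (CSeq c c') (t + t').+1 M3
| ExecIf M M' e c c' t :
    exec M (if truth (eval M e) then c else c') t M' ->
    exec M (CIf e c c') (ecost M e + t).+1 M'
| ExecWhileStop M e c :
    ~~ truth (eval M e) -> exec M (CWhile e c) (ecost M e).+1 M
| ExecWhileLoop M1 M2 M3 e c t t' :
    truth (eval M1 e) -> exec M1 c t M2 -> exec M2 (CWhile e c) t' M3 ->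
    exec M1 (CWhile e c) (ecost M1 e + t + t').+1 M3.

Lemma exec_det M c t1 M1 t2 M2 :
  exec M c t1 M1 -> exec M c t2 M2 -> t1 = t2 /\ M1 = M2.
Proof.
move=> H; elim: H t2 M2 => {M c t1 M1}; intros;
  match goal with H : exec _ ?c _ _ |- (_ = ?u) /\ (_ = ?N) =>
    match type of H with exec _ _ u N => inversion H; subst end end;
  repeat match goal with
  | IH : forall t M, exec ?M1 ?c t M -> _, H : exec ?M1 ?c _ _ |- _ =>
    case: (IH _ _ H) => ? ?; subst; clear H
  end; solve [by [] |
  match goal with H : is_true (~~ ?b), H' : is_true ?b |- _ => by case/negP: H end].
Qed.

Definition load (w : seq (value F)) : nat -> value F := nth (Num 0) w.

(* The input word is in bank 0, all other cells initially holding 0; the output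
   word is left in bank 1. *)
Definition init (w : seq (value F)) : memory F :=
  fun b => if b == 0%N then load w else fun=> Num 0.

(* One program maps the word [inp x] to the word [out x], for every x, at a cost
   polynomial in the size of [inp x]. *)
Definition polytime (X : Type) (inp out : X -> seq (value F)) : Prop :=
  exists (c : cmd F) (a k : nat), forall x : X,
    exists (t : nat) (M : memory F),
      [/\ exec (init (inp x)) c t M,
          (t <= a * wsize (inp x) ^ k + a)%N
        & M 1%N =1 load (out x)].

End Machine.

(** * Descriptions as words *)

(* The numbers of variables and vertices, the depth, the source, the sink, the
   list of variables, the level of each vertex, the number of edges, and for
   each edge its two ends and the m coefficients of its label. *)
Definition abp_word (F : fieldType) (m S : nat) (P : abp F m S) : seq (value F) :=
  let edges := [seq e <- enum {: 'I_S * 'I_S} | abp_rel P e.1 e.2] in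
  let coefs (e : 'I_S * 'I_S) :=
    if abp_edge P e.1 e.2 is Some l then [seq Elt (l i) | i <- enum 'I_m]
    else [::] in
  [:: Num m; Num S; Num (abp_depth P);
      Num (val (abp_source P)); Num (val (abp_sink P))]
  ++ [seq Num (val i) | i <- enum 'I_m]
  ++ [seq Num (abp_level P v) | v <- enum 'I_S]
  ++ Num (size edges)
  :: flatten [seq Num (val e.1) :: Num (val e.2) :: coefs e | e <- edges].

(* The entries of A_1, ..., A_m, each matrix row by row. *)
Definition mxs_word (F : fieldType) (m S : nat) (A : 'I_m -> 'M[F]_S) :
    seq (value F) :=
  flatten [seq [seq Elt (A i k l) | k <- enum 'I_S, l <- enum 'I_S]
          | i <- enum 'I_m].

(* Main.v *)
(* Number the vertices so that the source is first and the sink last, and let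
   A_i be the matrix of the coefficients of z_i in the edge labels.  For a word
   w = z_{i_1} ... z_{i_k}, the (1,S) entry of A_{i_1} ... A_{i_k} sums, over the
   source-to-sink paths of length k, the coefficient of w in the product of the
   labels.  This is the coefficient of w in g, as all those paths have the
   length of w or there are none.  By linearity the (1,S) entry of
   f(A_1 z_1, ..., A_m z_m) is the sum of f(w) g(w) w.

   The matrices are written by a program that first fills the output with zeros
   and then copies the m coefficients of each edge (u, v) to the cells with
   stride S^2 starting at p(u) S + p(v), p being the renumbering of the vertices.
   All numbers involved are at most polynomial in the input length, and field
   elements are only copied, so that each step costs polynomially much whatever
   the representation lengths are. *)
Require Import Defs.
From HB Require Import structures.
From mathcomp Require Import all_boot all_order all_algebra.
From mathcomp Require Import perm finmap zify.
From Stdlib Require Import FunctionalExtensionality.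

Set Implicit Arguments.
Unset Strict Implicit.
Unset Printing Implicit Defensive.

Import GRing.Theory Defs.

Local Open Scope ring_scope.

(** * Words and matrix products *)

Section Words.
Variables (F : fieldType) (m : nat).
Implicit Types (f h : ncpoly F m) (w : seq 'I_m).

(** Products and substitutions are sums over the support; writing a coefficient as such a sum allows
    a termwise comparison. *)
Lemma sum_msupp_delta f (w : {fmonom 'I_m}) :
  \sum_(k <- msupp f) f@_k *+ (k == w) = f@_w.
Proof.
rewrite {3}[f]monalgE raddf_sum /=.
by apply: eq_bigr => k _; rewrite mcoeffU.
Qed.

Lemma mcoeff_varM i h j w :
  (ncvar F i * h)@_(FMonom (j :: w)) = h@_(FMonom w) *+ (i == j).
Proof.
rewrite -[in RHS]sum_msupp_delta -sumrMnl malgM_def fgmulUg raddf_sum /=.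
apply: eq_bigr => k _; rewrite mcoeffU mul1r -mulrnA mulnb.
congr (_ *+ (nat_of_bool _)).
by rewrite -(inj_eq val_inj) /= fmM fmU -(inj_eq val_inj) /= eqseq_cons andbC.
Qed.

Lemma mcoeff_varM_nil i h : (ncvar F i * h)@_(FMonom [::]) = 0.
Proof.
rewrite malgM_def fgmulUg raddf_sum big1 //= => k _; rewrite mcoeffU.
by rewrite -(inj_eq val_inj) /= fmM fmU.
Qed.

Lemma scale_varE (a : F) (i : 'I_m) : a *: ncvar F i = << a *g fmu i >>.
Proof. by apply/malgP => w; rewrite mcoeffZ !mcoeffU mulrnAr mulr1. Qed.

(** Scalars commute with the variables, so the letters collect into one monomial common to all
    entries. *)
Lemma prod_mxvar n (A : 'I_m -> 'M[F]_n.+1) w :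
  \prod_(i <- w) mxvar A i =
    map_mx (fun a : F => << a *g FMonom w >>) (\prod_(i <- w) A i).
Proof.
elim: w => [|i w IHw].
  rewrite !big_nil; apply/matrixP => k l; rewrite !mxE -fmoneE.
  by case: eqP => _; rewrite ?monalgU0.
rewrite !big_cons IHw; apply/matrixP => k l; rewrite !mxE raddf_sum.
apply: eq_bigr => j _; rewrite !mxE scale_varE malgM_def fgmulUU.
by congr (<< _ *g _ >>); apply: val_inj; rewrite /= fmM fmU.
Qed.

(** By linearity in f: a word of the support contributes multiples of itself to the entries, so only
    w counts. *)
Lemma mcoeff_ncsubst n (A : 'I_m -> 'M[F]_n.+1) f k l (w : {fmonom 'I_m}) :
  (ncsubst (mxvar A) f k l)@_w = f@_w * (\prod_(i <- (w : seq 'I_m)) A i) k l.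
Proof.
rewrite -[in RHS](sum_msupp_delta f) mulr_suml summxE raddf_sum /=.
apply: eq_bigr => w' _.
rewrite prod_mxvar fmK [X in fun_of_matrix X _ _]mul_scalar_mx !mxE mcoeffCM mcoeffU.
by case: eqP => [->|_]; rewrite ?mulr1n // !mulr0n mulr0 mul0r.
Qed.

End Words.

(** * The matrices of a branching program *)

Section Walks.
Variables (F : fieldType) (m n : nat) (P : abp F m n.+1).

Definition abp_mx (i : 'I_m) : 'M[F]_n.+1 :=
  \matrix_(u, v) if abp_edge P u v is Some l then l i else 0.

Lemma abp_labelE u v : abp_label P u v = \sum_i abp_mx i u v *: ncvar F i.
Proof.
rewrite /abp_label; case E: (abp_edge P u v) => [l|]; last first.
  by rewrite big1 // => i _; rewrite mxE E scale0r.
by apply: eq_bigr => i _; rewrite mxE E.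
Qed.

(** The sum runs over all vertex tuples, not only over paths, since a missing edge has label 0; the
    start u is arbitrary for the induction on d. *)
Definition walk_poly d (u t : 'I_n.+1) : ncpoly F m :=
  \sum_(p : d.-tuple 'I_n.+1 | last u p == t)
    \prod_(l <- pairmap (abp_label P) u p) l.

Lemma walk_poly0 u t : walk_poly 0 u t = (u == t)%:R.
Proof.
rewrite /walk_poly (eq_bigl (fun p => (p == [tuple]) && (u == t))) /=; last first.
  move=> p; have /eqP-> : p = [tuple] by exact: tuple0.
  by rewrite (tuple0 p).
by rewrite big_andbC; case: eqP => _;
  rewrite ?big_pred1_eq ?big_nil ?big_pred0_eq // big_pred1_eq /= big_nil.
Qed.

Lemma walk_polyS d u t :
  walk_poly d.+1 u t = \sum_v abp_label P u v * walk_poly d v t.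
Proof.
rewrite /walk_poly (reindex (fun vp : 'I_n.+1 * d.-tuple 'I_n.+1 =>
  cons_tuple vp.1 vp.2)) /=; last first.
  exists (fun p : d.+1.-tuple 'I_n.+1 => (thead p, behead_tuple p)).
    by case=> v p _ /=; congr (_, _); apply: val_inj.
  by move=> p _; rewrite /= [RHS]tuple_eta; apply: val_inj.
rewrite -(pair_big_dep xpredT (fun v (p : d.-tuple 'I_n.+1) => last v p == t)
  (fun v p => \prod_(l <- abp_label P u v :: pairmap (abp_label P) v p) l)) /=.
apply: eq_bigr => v _; rewrite mulr_sumr.
by apply: eq_bigr => p _; rewrite big_cons.
Qed.

(** Induction on d removes the first step of the walk and the first letter of the word; in the label
    of that step only the term of that letter contributes. *)
Lemma mcoeff_walk_poly d u t (w : seq 'I_m) :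
  (walk_poly d u t)@_(FMonom w) =
    (\prod_(i <- w) abp_mx i) u t *+ (size w == d).
Proof.
elim: d u w => [|d IHd] u w.
  rewrite walk_poly0; case: w => [|i w] /=.
    rewrite big_nil mxE; case: eqP => _; last by rewrite mcoeff0.
    by rewrite -fmoneE mcoeff1 eqxx.
  by case: eqP => _; rewrite ?mcoeff0 // mcoeff1 -(inj_eq val_inj) /= fm1.
rewrite walk_polyS raddf_sum /=; case: w => [|i w].
  rewrite big1 // => v _; rewrite abp_labelE mulr_suml raddf_sum big1 //= => i _.
  by rewrite -scalerAl mcoeffZ mcoeff_varM_nil mulr0.
rewrite big_cons mxE -sumrMnl; apply: eq_bigr => v _.
rewrite abp_labelE mulr_suml raddf_sum (bigD1 i) //= big1 => [|j ji].
  by rewrite -scalerAl mcoeffZ mcoeff_varM eqxx mulr1n IHd addr0 mulrnAr.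
by rewrite -scalerAl mcoeffZ mcoeff_varM (negbTE ji) mulr0.
Qed.

(** A tuple that fails to be a path crosses a missing edge, whose zero label kills the product. *)
Lemma abp_polyE : abp_poly P = walk_poly (abp_depth P) (abp_source P) (abp_sink P).
Proof.
rewrite /abp_poly /walk_poly /abp_path [LHS]big_mkcondl.
apply: eq_bigr => p _; case: ifP => // /negbT; move: (abp_source P) => u.
elim: (val p) u => //= v q IHq u; rewrite big_cons negb_and.
case/orP => [|/IHq <-]; last by rewrite mulr0.
by rewrite /abp_rel /abp_label; case: (abp_edge P u v) => // _; rewrite mul0r.
Qed.

(** A nonzero entry of the product has a nonzero term, hence comes from a walk along edges, each
    raising the level by one. *)
Lemma abp_mx_word_level (w : seq 'I_m) u t :
  (\prod_(i <- w) abp_mx i) u t != 0 ->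
  abp_level P t = (abp_level P u + size w)%N.
Proof.
elim: w u => [|i w IHw] u.
  by rewrite big_nil mxE addn0; case: (u =P t) => [->|] //; rewrite eqxx.
rewrite big_cons mxE => nz.
have [v]: exists v, abp_mx i u v * (\prod_(j <- w) abp_mx j) v t != 0.
  apply/existsP; apply: contraNT nz; rewrite negb_exists => /forallP z.
  by rewrite big1 // => v _; apply/eqP; have := z v; rewrite negbK.
rewrite mulf_eq0 negb_or mxE => /andP[uv /IHw ->].
have -> : abp_level P v = (abp_level P u).+1.
  by apply: abp_edge_level; move: uv; case: (abp_edge P u v); rewrite ?eqxx.
by rewrite addSnnS.
Qed.

(** For a word whose length is not the depth the entry itself vanishes: otherwise the level of the
    sink would be that length. *)
Lemma mcoeff_abp_poly (w : {fmonom 'I_m}) :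
  (abp_poly P)@_w =
    (\prod_(i <- (w : seq 'I_m)) abp_mx i) (abp_source P) (abp_sink P).
Proof.
rewrite abp_polyE -[w in LHS]fmK mcoeff_walk_poly.
case: eqP => // ne; rewrite mulr0n; apply/esym/eqP/negPn/negP.
move=> /abp_mx_word_level.
have /eqP -> : abp_level P (abp_sink P) == abp_depth P by rewrite abp_level_sink.
have /eqP -> : abp_level P (abp_source P) == 0%N by rewrite abp_level_source.
by move=> /esym.
Qed.

(* The second transposition fixes ord0: source and sink differ unless n = 0. *)
Definition abp_perm : {perm 'I_n.+1} :=
  tperm ord0 (abp_source P) *
  tperm ord_max (tperm ord0 (abp_source P) (abp_sink P)).

Lemma abp_perm_sink : abp_perm (abp_sink P) = ord_max.
Proof. by rewrite permM tpermR. Qed.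

(** If they agree, the depth is 0, so every vertex has level 0 and is the source. *)
Lemma source_neq_sink : (0 < n)%N -> abp_source P != abp_sink P.
Proof.
move=> n0; apply/eqP => ss.
have d0 : abp_depth P = 0%N.
  have /eqP <- : abp_level P (abp_sink P) == abp_depth P.
    by rewrite abp_level_sink.
  by apply/eqP; rewrite abp_level_source ss.
have all_src v : v = abp_source P.
  apply/eqP; rewrite -abp_level_source.
  by have := abp_level_le P v; rewrite d0 leqn0.
by have := congr1 val (etrans (all_src ord0) (esym (all_src ord_max))) => /=; lia.
Qed.

Lemma abp_perm_source : abp_perm (abp_source P) = ord0.
Proof.
rewrite permM tpermR; have [n0|n_gt0] := posnP n.
  apply: ord_inj; move: (tperm ord_max _ _) => k.
  by have := ltn_ord k; rewrite [in X in (_ < X)%N]n0 ltnS leqn0 => /eqP.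
(* [ord0] is neither [ord_max] nor the image of the sink under the first transposition, which sends
   the source there. *)
rewrite [tperm ord_max _ _]tpermD //; first by rewrite -lt0n.
rewrite -{2}(tpermR ord0 (abp_source P)) (inj_eq perm_inj).
by rewrite eq_sym source_neq_sink.
Qed.

Definition abp_mx_perm (i : 'I_m) : 'M[F]_n.+1 :=
  \matrix_(k, l) abp_mx i (abp_perm^-1 k)%g (abp_perm^-1 l)%g.

Lemma prod_abp_mx_perm (w : seq 'I_m) u v :
  (\prod_(i <- w) abp_mx_perm i) (abp_perm u) (abp_perm v) =
    (\prod_(i <- w) abp_mx i) u v.
Proof.
elim: w u => [|i w IHw] u; first by rewrite !big_nil !mxE (inj_eq perm_inj).
rewrite !big_cons !mxE (reindex_perm abp_perm).
by apply: eq_bigr => j _; rewrite IHw mxE !permK.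
Qed.

Lemma hadamard_abp_poly (f : ncpoly F m) :
  hadamard f (abp_poly P) = ncsubst (mxvar abp_mx_perm) f ord0 ord_max.
Proof.
apply/malgP => w; rewrite hadamardE mcoeff_ncsubst mcoeff_abp_poly.
by rewrite -prod_abp_mx_perm abp_perm_source abp_perm_sink.
Qed.

End Walks.

(** * Costs of straight-line code and of counting loops *)

Section Costs.
Variables (F : fieldType) (esize : F -> nat).
Implicit Types (M : memory F) (e : expr F) (c : cmd F).

(* e contains no field operation, so that its value is not much longer than the
   memory cells that it reads, whatever esize is. *)
Fixpoint numeric M e : bool :=
  match e with
  | ECst _ => true
  | EGet _ e1 => numeric M e1
  | EBin _ e1 e2 =>
      [&& numeric M e1, numeric M e2,
          (if eval M e1 is Num _ then true else false)
        & (if eval M e2 is Num _ then true else false)]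
  | EInv _ => false
  end.

(** Meant for addresses and counters; an expression that copies a field element is only
    [numeric]. *)
Definition natval M e (a : nat) : Prop := numeric M e /\ eval M e = Num a.

Lemma natval_cst M a : natval M (ECst (Num a)) a.
Proof. by []. Qed.

Lemma natval_get M b e a a' :
  natval M e a -> M b a = Num a' -> natval M (EGet b e) a'.
Proof. by case=> e_num e_eq Mba; split; rewrite /= ?e_eq. Qed.

Lemma natval_bin M o e1 e2 a1 a2 :
  natval M e1 a1 -> natval M e2 a2 ->
  natval M (EBin o e1 e2)
    match o with OpAdd => a1 + a2 | OpSub => a1 - a2 | OpMul => a1 * a2 end%N.
Proof. by case=> num1 val1 [num2 val2]; split; rewrite /= ?num1 ?num2 val1 val2. Qed.

Lemma natval_eq M e a b : natval M e a -> a = b -> natval M e b.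
Proof. by move=> ea <-. Qed.

(** A measure independent of the memory: when all cells have size at most L, it bounds the size of a
    numeric value, and its square the cost, in units of L. *)
Fixpoint weight e : nat :=
  match e with
  | ECst v => vsize esize v
  | EGet _ e1 => (weight e1).+1
  | EBin _ e1 e2 => (weight e1 + weight e2).+1
  | EInv e1 => (weight e1).+1
  end.

Definition bounded M (L : nat) : Prop := forall b i, (vsize esize (M b i) <= L)%N.

Lemma vsize_gt0 (v : value F) : (0 < vsize esize v)%N.
Proof. by case: v. Qed.

Lemma bounded_gt0 M L : bounded M L -> (0 < L)%N.
Proof. by move=> /(_ 0%N 0%N); apply: leq_trans; apply: vsize_gt0. Qed.

Lemma vsize_num_le a : (vsize esize (Num a) <= a.+1)%N.
Proof.
rewrite /= ltnS; case: a => [|a]; first by rewrite trunc_log0.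
exact/ltnW/(leq_trans (ltn_expl _ (ltnSn 1)))/trunc_logP.
Qed.

(** Each result is below (a + 1)(b + 1), and a + 1 and b + 1 are at most 2 to the bit lengths of a
    and b. *)
Lemma vsize_binop o a b :
  (vsize esize (binop_val o (Num a) (Num b))
     <= vsize esize (Num a) + vsize esize (Num b))%N.
Proof.
rewrite /=; set k := match o with OpAdd => _ | _ => _ end.
have k_lt : (k < a.+1 * b.+1)%N by rewrite {}/k; case: o; nia.
have [->|k_gt0] := posnP k; first by rewrite trunc_log0; lia.
rewrite -(ltn_exp2l _ _ (ltnSn 1)) expnD.
apply: leq_ltn_trans (trunc_logP (ltnSn 1) k_gt0) _.
by apply: leq_trans k_lt _; apply: leq_mul; apply: trunc_log_ltn.
Qed.

(** Every node pays for the size of its value, which is linear in the weight; squaring the weight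
    absorbs the sum of these payments. *)
Lemma numeric_cost M L e : bounded M L -> numeric M e ->
  (vsize esize (eval M e) <= weight e * L)%N
  /\ (ecost esize M e <= weight e ^ 2 * L)%N.
Proof.
move=> M_le; have bound_gt0 := bounded_gt0 M_le.
elim: e => [v|b e IHe|o e1 IH1 e2 IH2|//] /=.
- by move=> _; rewrite addn0; have := vsize_gt0 v; nia.
- by move=> /IHe[le1 le2]; have := M_le b (address (eval M e)); nia.
case/and4P => /IH1[] + + /IH2[].
case: (eval M e1) => // a; case: (eval M e2) => // b v1 c1 v2 c2 _ _.
by have := vsize_binop o a b; nia.
Qed.

(** Meaningful for sequences of assignments only; loops are charged by [runs_while], and 0 is a
    default. *)
Fixpoint cweight c : nat :=
  match c with
  | CSet _ e e' => (weight e ^ 2 + weight e' ^ 2).+1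
  | CSeq c c' => (cweight c + cweight c').+1
  | _ => 0
  end.

Definition runs M c (B : nat) M' : Prop :=
  exists2 t, exec esize M c t M' & (t <= B)%N.

Lemma runs_set M L b e e' a v M' :
  bounded M L -> natval M e a -> numeric M e' -> eval M e' = v ->
  update M b a v = M' ->
  runs M (CSet b e e') (cweight (CSet b e e') * L) M'.
Proof.
move=> M_le [e_num ea] e'_num <- <-.
exists (ecost esize M e + ecost esize M e').+1.
  by have := ExecSet esize M b e e'; rewrite ea.
have [_ c1] := numeric_cost M_le e_num; have [_ c2] := numeric_cost M_le e'_num.
by have := bounded_gt0 M_le; rewrite [cweight _]/=; nia.
Qed.

Lemma runs_seq M1 M2 M3 c c' K K' L :
  (0 < L)%N -> runs M1 c (K * L) M2 -> runs M2 c' (K' * L) M3 ->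
  runs M1 (CSeq c c') ((K + K').+1 * L) M3.
Proof.
move=> bound_gt0 [t ex_c le_t] [t' ex_c' le_t'].
by exists (t + t').+1; [apply: ExecSeq ex_c ex_c' | nia].
Qed.

(** The loop is followed through a given sequence of states while its guard counts down from N to
    0. *)
Lemma runs_while (St : nat -> memory F) N e c K L :
  (forall k, (k <= N)%N -> bounded (St k) L) ->
  (forall k, (k <= N)%N -> natval (St k) e (N - k)) ->
  (forall k, (k < N)%N -> runs (St k) c (K * L) (St k.+1)) ->
  runs (St 0%N) (CWhile e c) ((N.+1 * (weight e ^ 2 + K).+1) * L) (St N).
Proof.
move=> St_le e_val c_run.
have bound_gt0 := bounded_gt0 (St_le 0%N (leq0n N)).
pose C := ((weight e ^ 2 + K).+1 * L)%N.
(* Generalized to a loop entered at state k with d passes left, for induction on d. *)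
suff loop d k : (k + d)%N = N -> runs (St k) (CWhile e c) (d.+1 * C) (St N).
  by rewrite -mulnA; apply: loop.
elim: d k => [|d IHd] k kd.
all: have kN : (k <= N)%N by lia.
all: have [e_num e_eq] := e_val k kN.
all: have [_ e_cost] := numeric_cost (St_le k kN) e_num.
  have -> : N = k by lia.
  exists (ecost esize (St k) e).+1; last by rewrite mul1n /C; nia.
  by apply: ExecWhileStop; rewrite e_eq /=; lia.
have [|t ex_t le_t] := c_run k; first by lia.
have [|t' ex_t' le_t'] := IHd k.+1; first by lia.
exists (ecost esize (St k) e + t + t').+1.
  by apply: ExecWhileLoop ex_t ex_t'; rewrite e_eq /=; lia.
by rewrite mulSn; move: le_t'; rewrite /C; nia.
Qed.

End Costs.

(** * The program *)

Section Program.
Variable F : fieldType.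

Definition swapn (x y z : nat) : nat :=
  if z == x then y else if z == y then x else z.

Local Notation num a := (ECst (@Num F a)).
Local Notation "a :+: b" := (EBin OpAdd a b) (at level 50).
Local Notation "a :-: b" := (EBin OpSub a b) (at level 50).
Local Notation "a :*: b" := (EBin OpMul a b) (at level 40).
Local Notation inp e := (EGet 0 e).
Local Notation var j := (EGet 2 (num j)).
Local Notation "x :- e" := (CSet 2 (num x) e) (at level 70).
Local Notation "c ;; c'" := (CSeq c c') (at level 80, right associativity).

(* With truncated subtraction, 1 - ((a - b) + (b - a)) is 1 if a = b, else 0. *)
Definition eqE (a b : expr F) : expr F := num 1 :-: ((a :-: b) :+: (b :-: a)).

(** The choice is made by multiplying with indicators, so the code stays free of branching and
    within reach of [cweight]. *)
Definition swapE (x y z : expr F) : expr F :=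
  (eqE z x :*: y) :+:
  ((num 1 :-: eqE z x) :*:
     ((eqE z y :*: x) :+: ((num 1 :-: eqE z y) :*: z))).

(** Input cells 1, 3 and 4 hold S, the source and the sink; the nested swaps are the two
    transpositions of [abp_perm], with 0 and S - 1 for [ord0] and [ord_max]. *)
Definition relabelE (e : expr F) : expr F :=
  swapE (inp (num 1) :-: num 1)
    (swapE (num 0) (inp (num 3)) (inp (num 4)))
    (swapE (num 0) (inp (num 3)) e).

(** Works downwards, the decremented counter being the address. The field element 0 has to replace
    the number 0 of the initial memory. *)
Definition fill_body : cmd F :=
  0 :- (var 0 :-: num 1) ;; CSet 1 (var 0) (ECst (Elt 0)).

Definition entry_body : cmd F :=
  CSet 1 (var 2) (inp (var 1)) ;;
  1 :- (var 1 :+: num 1) ;;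
  2 :- (var 2 :+: (inp (num 1) :*: inp (num 1))) ;;
  3 :- (var 3 :-: num 1).

Definition edge_setup : cmd F :=
  0 :- (var 0 :-: num 1) ;;
  2 :- ((relabelE (inp (var 1)) :*: inp (num 1))
        :+: relabelE (inp (var 1 :+: num 1))) ;;
  1 :- (var 1 :+: num 2) ;;
  3 :- inp (num 0).

Definition edge_body : cmd F := edge_setup ;; CWhile (var 3) entry_body.

Definition fill_setup : cmd F :=
  0 :- (inp (num 0) :*: (inp (num 1) :*: inp (num 1))).

(** Five header cells, m variables and S levels precede the number of edges; the edges follow it. *)
Definition edges_setup : cmd F :=
  0 :- inp (num 5 :+: (inp (num 0) :+: inp (num 1))) ;;
  1 :- (num 6 :+: (inp (num 0) :+: inp (num 1))).

(* Bank 2 holds the variables: 0 is a loop counter, 1 the position in the input,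
   2 the position in the output and 3 the counter of the inner loop. *)
Definition abp_cmd : cmd F :=
  fill_setup ;; CWhile (var 0) fill_body ;;
  edges_setup ;; CWhile (var 0) edge_body.

Lemma natval_swap (M : memory F) ex ey ez x y z :
  natval M ex x -> natval M ey y -> natval M ez z ->
  natval M (swapE ex ey ez) (swapn x y z).
Proof.
move=> vx vy vz; have v1 := natval_cst M 1.
have veq ea eb a b : natval M ea a -> natval M eb b -> natval M (eqE ea eb) (a == b).
  move=> va vb; have := natval_bin OpSub v1
    (natval_bin OpAdd (natval_bin OpSub va vb) (natval_bin OpSub vb va)).
  by congr natval; case: eqP; lia.
have := natval_bin OpAdd (natval_bin OpMul (veq _ _ _ _ vz vx) vy)
  (natval_bin OpMul (natval_bin OpSub v1 (veq _ _ _ _ vz vx))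
    (natval_bin OpAdd (natval_bin OpMul (veq _ _ _ _ vz vy) vx)
      (natval_bin OpMul (natval_bin OpSub v1 (veq _ _ _ _ vz vy)) vz))).
by congr natval; rewrite /swapn; case: eqP; case: eqP; lia.
Qed.

(** * Memory states reached by the program *)

Definition set_cell (o : nat -> value F) (i : nat) (v : value F) : nat -> value F :=
  fun i' => if i' == i then v else o i'.

Definition state (w : seq (value F)) (o : nat -> value F) (x0 x1 x2 x3 : nat) :
    memory F :=
  fun b => match b with
  | 0 => load w
  | 1 => o
  | 2 => nth (Num 0) [:: Num x0; Num x1; Num x2; Num x3]
  | _ => fun=> Num 0
  end%N.

(** Executions are stated with equality of memories, which are functions. *)
Lemma memory_ext (M M' : memory F) : (forall b i, M b i = M' b i) -> M = M'.
Proof.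
by move=> eqM; apply: functional_extensionality => b;
  apply: functional_extensionality => i.
Qed.

Lemma init_state w : init w = state w (fun=> Num 0) 0 0 0 0.
Proof. by apply: memory_ext => -[|[|[|b]]] //= -[|[|[|[|[|i]]]]]. Qed.

Section State.
Variables (w : seq (value F)) (o : nat -> value F) (x0 x1 x2 x3 : nat).
Local Notation st := (state w o x0 x1 x2 x3).

Lemma update_out i v : update st 1 i v = state w (set_cell o i v) x0 x1 x2 x3.
Proof. by apply: memory_ext => -[|[|[|b]]]. Qed.

Lemma update_var0 y : update st 2 0 (Num y) = state w o y x1 x2 x3.
Proof. by apply: memory_ext => -[|[|[|b]]] //= -[|[|[|[|i]]]]. Qed.

Lemma update_var1 y : update st 2 1 (Num y) = state w o x0 y x2 x3.
Proof. by apply: memory_ext => -[|[|[|b]]] //= -[|[|[|[|i]]]]. Qed.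

Lemma update_var2 y : update st 2 2 (Num y) = state w o x0 x1 y x3.
Proof. by apply: memory_ext => -[|[|[|b]]] //= -[|[|[|[|i]]]]. Qed.

Lemma update_var3 y : update st 2 3 (Num y) = state w o x0 x1 x2 y.
Proof. by apply: memory_ext => -[|[|[|b]]] //= -[|[|[|[|i]]]]. Qed.

(** A crude bound suffices: a number below L has size at most L. *)
Lemma bounded_state (esize : F -> nat) L :
  (forall i, vsize esize (load w i) <= L)%N ->
  (forall i, vsize esize (o i) <= L)%N ->
  (x0 < L)%N -> (x1 < L)%N -> (x2 < L)%N -> (x3 < L)%N ->
  bounded esize st L.
Proof.
move=> w_le o_le h0 h1 h2 h3.
have num_le x : (x < L)%N -> (vsize esize (Num x) <= L)%N.
  exact/leq_trans/vsize_num_le.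
have v0 : (vsize esize (Num 0) <= L)%N by apply: num_le; lia.
by case=> [|[|[|b]]] //= [|[|[|[|i]]]] /=; rewrite ?nth_nil //; apply: num_le.
Qed.

End State.

(** * Execution of the loops on a word with the layout of a program description *)

Section Execution.
Variables (esize : F -> nat) (L : nat) (w : seq (value F)).
Variables (m S s t E : nat) (u v : nat -> nat).
Hypothesis w_m : load w 0 = Num m.
Hypothesis w_S : load w 1 = Num S.
Hypothesis w_s : load w 3 = Num s.
Hypothesis w_t : load w 4 = Num t.
Hypothesis w_E : load w (5 + (m + S)) = Num E.

Definition relabel (x : nat) : nat :=
  swapn (S - 1) (swapn 0 s t) (swapn 0 s x).

Definition edge_pos (k : nat) : nat := (6 + (m + S) + k * (m + 2))%N.

Definition edge_cell (k : nat) : nat := (relabel (u k) * S + relabel (v k))%N.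

Hypothesis w_u : forall k, (k < E)%N -> load w (edge_pos k) = Num (u k).
Hypothesis w_v : forall k, (k < E)%N -> load w (edge_pos k + 1) = Num (v k).

(** The output once the downward filling loop has reached cell c. *)
Definition fill (N c : nat) : nat -> value F :=
  fun i => if (c <= i < N)%N then Elt 0 else Num 0.

Definition write_entries (p q j : nat) (o : nat -> value F) : nat -> value F :=
  iteri j (fun i o' => set_cell o' (q + i * (S * S)) (load w (p + i))) o.

Definition write_edges (k : nat) : nat -> value F :=
  iteri k (fun i => write_entries (edge_pos i + 2) (edge_cell i) m)
    (fill (m * (S * S)) 0).

(** L bounds the input cells, the zero that is written and every counter and address held by the
    variables, so that all states reached are [bounded]. *)
Hypothesis w_le : forall i, (vsize esize (load w i) <= L)%N.
Hypothesis zero_le : (vsize esize (Elt 0%R) <= L)%N.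
Hypothesis m_lt : (m < L)%N.
Hypothesis E_lt : (E < L)%N.
Hypothesis fill_lt : (m * (S * S) < L)%N.
Hypothesis pos_lt : (edge_pos E < L)%N.
Hypothesis cell_lt : forall k, (k < E)%N -> (edge_cell k + m * (S * S) < L)%N.

Lemma bound_gt0 : (0 < L)%N. Proof. exact: leq_ltn_trans m_lt. Qed.

Lemma fill_le N c i : (vsize esize (fill N c i) <= L)%N.
Proof.
rewrite /fill; case: ifP => _; first exact: zero_le.
by apply: (leq_trans _ bound_gt0); rewrite /= trunc_log0.
Qed.

Lemma write_entriesS p q j o :
  write_entries p q j.+1 o =
    set_cell (write_entries p q j o) (q + j * (S * S)) (load w (p + j)).
Proof. by []. Qed.

Lemma write_edgesS k :
  write_edges k.+1 =
    write_entries (edge_pos k + 2) (edge_cell k) m (write_edges k).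
Proof. by []. Qed.

Lemma write_entries_le p q j o :
  (forall i, vsize esize (o i) <= L)%N ->
  forall i, (vsize esize (write_entries p q j o i) <= L)%N.
Proof.
move=> o_le; elim: j => [|j IHj] i; first exact: o_le.
by rewrite write_entriesS /set_cell; case: eqP.
Qed.

Lemma write_edges_le k i : (vsize esize (write_edges k i) <= L)%N.
Proof.
elim: k i => [|k IHk] i; first exact: fill_le.
by rewrite write_edgesS; apply: write_entries_le.
Qed.

(** Evaluates an expression along its syntax, taking the contents of input cells from the section
    hypotheses. *)
Ltac natval_tac :=
  first [ exact: natval_cst
        | apply: natval_bin; natval_tac
        | apply: natval_get; [natval_tac | by rewrite //=; eauto] ].

Ltac natval_lia := eapply natval_eq; [natval_tac | lia].

Lemma natval_relabel o x0 x1 x2 x3 e x :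
  natval (state w o x0 x1 x2 x3) e x ->
  natval (state w o x0 x1 x2 x3) (relabelE e) (relabel x).
Proof.
move=> e_x; have inp_j j y : load w j = Num y ->
  natval (state w o x0 x1 x2 x3) (inp (num j)) y by move=> ?; apply: natval_get.
have zero := natval_cst (state w o x0 x1 x2 x3) 0.
apply: natval_swap; [|exact: natval_swap (inp_j _ _ w_s) (inp_j _ _ w_t)|].
  exact: natval_bin (inp_j _ _ w_S) (natval_cst _ 1).
exact: natval_swap (inp_j _ _ w_s) e_x.
Qed.

Lemma runs_var (M M' : memory F) (x : nat) e a :
  bounded esize M L -> natval M e a -> update M 2 x (Num a) = M' ->
  runs esize M (x :- e) (cweight esize (x :- e) * L) M'.
Proof. by move=> M_le [e_num e_a]; apply: runs_set. Qed.

Ltac bounded_tac :=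
  apply: bounded_state; first [ exact: w_le | by [] | lia ].

Lemma runs_fill N : (N < L)%N ->
  runs esize (state w (fun=> Num 0) N 0 0 0) (CWhile (var 0) fill_body)
    (N.+1 * (weight esize (var 0) ^ 2 + cweight esize fill_body).+1 * L)
    (state w (fill N 0) 0 0 0 0).
Proof.
move=> N_lt.
have St_le c : (c <= N)%N -> bounded esize (state w (fill N c) c 0 0 0) L.
  by move=> cN; have f_le := fill_le N c; bounded_tac.
(* Nothing is filled yet: the interval from N to N is empty. *)
have -> : (fun=> Num 0) = fill N N.
  by apply: functional_extensionality => i; rewrite /fill ltnNge; case: leqP.
have := @runs_while F esize (fun k => state w (fill N (N - k)) (N - k) 0 0 0) N.
rewrite subn0 subnn; apply; first by move=> k kN; apply: St_le; lia.
  by move=> k kN; natval_tac.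
move=> k kN; have [c Nk] : exists c, (N - k)%N = c.+1 by exists (N - k.+1)%N; lia.
have -> : (N - k.+1 = c)%N by lia.
rewrite Nk.
apply: (runs_seq (M2 := state w (fill N c.+1) c 0 0 0)) bound_gt0 _ _.
  by apply: runs_var (update_var0 _ _ _ _ _ _ _); [apply: St_le; lia | natval_lia].
have fill_c : set_cell (fill N c.+1) c (Elt 0) = fill N c.
  apply: functional_extensionality => i; rewrite /set_cell /fill.
  have [->|ne] := eqVneq i c; first by case: ifP => //; lia.
  by congr (if _ then _ else _); lia.
rewrite -fill_c; apply: (runs_set _ _ _ _ (update_out _ _ _ _ _ _ _ _)) => //.
by have f_le := fill_le N c.+1; bounded_tac.
Qed.

Lemma runs_entries o x0 p q :
  (forall i, vsize esize (o i) <= L)%N ->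
  (x0 < L)%N -> (p + m < L)%N -> (q + m * (S * S) < L)%N ->
  runs esize (state w o x0 p q m) (CWhile (var 3) entry_body)
    (m.+1 * (weight esize (var 3) ^ 2 + cweight esize entry_body).+1 * L)
    (state w (write_entries p q m o) x0 (p + m) (q + m * (S * S)) 0).
Proof.
move=> o_le x0_lt p_lt q_lt.
have := @runs_while F esize (fun j => state w (write_entries p q j o) x0
  (p + j) (q + j * (S * S)) (m - j)) m.
rewrite !addn0 subn0 subnn; apply => [j jm|j jm|j jm].
- have := write_entries_le p q j o_le; have : (j * (S * S) <= m * (S * S))%N.
    by rewrite leq_mul2r jm orbT.
  by move=> ? ?; bounded_tac.
- by natval_tac.
have := write_entries_le p q j o_le; have := write_entries_le p q j.+1 o_le.
(* Keeps the next output address below L. *)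
have jS : ((j * (S * S)) + S * S <= m * (S * S))%N.
  by rewrite addnC -mulSn leq_mul2r jm orbT.
rewrite write_entriesS => ? ?.
apply: (runs_seq (M2 := state w (write_entries p q j.+1 o) x0 (p + j)
    (q + j * (S * S)) (m - j))) bound_gt0 _ _.
  rewrite write_entriesS; apply: (runs_set _ _ _ erefl (update_out _ _ _ _ _ _ _ _)).
  - by bounded_tac.
  - by natval_tac.
  - by [].
rewrite -write_entriesS.
apply: (runs_seq (M2 := state w (write_entries p q j.+1 o) x0 (p + j.+1)
    (q + j * (S * S)) (m - j))) bound_gt0 _ _.
  by apply: runs_var (update_var1 _ _ _ _ _ _ _); [bounded_tac | natval_lia].
apply: (runs_seq (M2 := state w (write_entries p q j.+1 o) x0 (p + j.+1)
    (q + j.+1 * (S * S)) (m - j))) bound_gt0 _ _.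
  by apply: runs_var (update_var2 _ _ _ _ _ _ _); [bounded_tac | natval_lia].
by apply: runs_var (update_var3 _ _ _ _ _ _ _); [bounded_tac | natval_lia].
Qed.

Definition edge_weight : nat :=
  (cweight esize edge_setup
   + m.+1 * (weight esize (var 3) ^ 2 + cweight esize entry_body).+1).+1.

(** Variable 2 enters with the position left by the previous edge, here any [x2], and is reset by
    the setup. *)
Lemma runs_edge k x2 : (k < E)%N -> (x2 < L)%N ->
  runs esize (state w (write_edges k) (E - k) (edge_pos k) x2 0) edge_body
    (edge_weight * L)
    (state w (write_edges k.+1) (E - k.+1) (edge_pos k.+1)
       (edge_cell k + m * (S * S)) 0).
Proof.
move=> kE x2_lt; have o_le := write_edges_le k.
have pos_k : (edge_pos k + m.+2 <= edge_pos E)%N.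
  have : (k.+1 * (m + 2) <= E * (m + 2))%N by rewrite leq_mul2r kE orbT.
  by rewrite /edge_pos mulSn; lia.
have pos_kS : edge_pos k.+1 = (edge_pos k + 2 + m)%N.
  by rewrite /edge_pos mulSn; lia.
have cell_k := cell_lt kE.
apply: (runs_seq (M2 := state w (write_edges k) (E - k.+1) (edge_pos k + 2)
    (edge_cell k) m)) bound_gt0 _ _; last first.
  rewrite pos_kS write_edgesS.
  by apply: runs_entries; [exact: write_edges_le | lia | lia | lia].
apply: (runs_seq (M2 := state w (write_edges k) (E - k.+1) (edge_pos k)
    x2 0)) bound_gt0 _ _.
  by apply: runs_var (update_var0 _ _ _ _ _ _ _); [bounded_tac | natval_lia].
apply: (runs_seq (M2 := state w (write_edges k) (E - k.+1) (edge_pos k)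
    (edge_cell k) 0)) bound_gt0 _ _.
  apply: runs_var (update_var2 _ _ _ _ _ _ _); first by bounded_tac.
  apply: (natval_bin OpAdd); last first.
    apply: natval_relabel; apply: natval_get; first by natval_tac.
    exact: w_v.
  apply: (natval_bin OpMul); last by natval_tac.
  apply: natval_relabel; apply: natval_get; first by natval_tac.
  exact: w_u.
apply: (runs_seq (M2 := state w (write_edges k) (E - k.+1) (edge_pos k + 2)
    (edge_cell k) 0)) bound_gt0 _ _.
  by apply: runs_var (update_var1 _ _ _ _ _ _ _); [bounded_tac | natval_tac].
by apply: runs_var (update_var3 _ _ _ _ _ _ _); [bounded_tac | natval_tac].
Qed.

Definition abp_cmd_weight : nat :=
  (cweight esize fill_setup
   + ((m * (S * S)).+1 * (weight esize (var 0) ^ 2 + cweight esize fill_body).+1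
      + (cweight esize edges_setup
         + E.+1 * (weight esize (var 0) ^ 2 + edge_weight).+1).+1).+1).+1.

Lemma runs_abp_cmd : exists p q,
  runs esize (init w) abp_cmd (abp_cmd_weight * L)
    (state w (write_edges E) 0 p q 0).
Proof.
(* Variable 2 at the start of pass k: 0 at first, then the position one stride past the last entry
   of the previous edge. *)
pose x2 k := if k is k'.+1 then (edge_cell k' + m * (S * S))%N else 0%N.
have x2_lt k : (k <= E)%N -> (x2 k < L)%N.
  by case: k => [|k] //= kE; [exact: bound_gt0 | exact: cell_lt].
exists (edge_pos E), (x2 E); rewrite init_state.
have num0_le : (vsize esize (@Num F 0) <= L)%N by exact: fill_le 0 0 0.
apply: (runs_seq (M2 := state w (fun=> Num 0) (m * (S * S)) 0 0 0)) bound_gt0 _ _.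
  by apply: runs_var (update_var0 _ _ _ _ _ _ _); [bounded_tac | natval_tac].
apply: runs_seq bound_gt0 (runs_fill fill_lt) _.
have f_le := fill_le (m * (S * S)) 0; have o_le := write_edges_le 0.
apply: (runs_seq (M2 := state w (write_edges 0) E (edge_pos 0) 0 0)) bound_gt0 _ _.
  apply: (runs_seq (M2 := state w (write_edges 0) E 0 0 0)) bound_gt0 _ _.
    by apply: runs_var (update_var0 _ _ _ _ _ _ _); [bounded_tac | natval_tac].
  apply: runs_var (update_var1 _ _ _ _ _ _ _); first by bounded_tac.
  by rewrite /edge_pos; natval_lia.
have := @runs_while F esize (fun k => state w (write_edges k) (E - k)
  (edge_pos k) (x2 k) 0) E.
rewrite subn0 subnn; apply => [k kE|k kE|k kE].
- have := x2_lt k kE; have := write_edges_le k.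
  have : (edge_pos k <= edge_pos E)%N by rewrite leq_add2l leq_mul2r kE orbT.
  by move=> ? ? ?; bounded_tac.
- by natval_tac.
by apply: runs_edge; [|apply: x2_lt; lia].
Qed.

End Execution.

End Program.

(** * Correctness of the output *)

Section Flatten.
Variables (T : Type) (x0 : T) (c : nat).

Lemma size_flatten_const (ss : seq (seq T)) :
  all (fun s => size s == c) ss -> size (flatten ss) = (size ss * c)%N.
Proof.
elim: ss => //= s ss IHss /andP[/eqP sc /IHss].
by rewrite size_cat sc mulSn => ->.
Qed.

Lemma nth_flatten_const (ss : seq (seq T)) k r :
  all (fun s => size s == c) ss -> (r < c)%N ->
  nth x0 (flatten ss) (k * c + r) = nth x0 (nth [::] ss k) r.
Proof.
move=> + rc; elim: ss k => [|s ss IHss] k /=; first by rewrite !nth_nil.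
case/andP => /eqP sc /IHss IH; rewrite nth_cat sc.
case: k => [|k] /=; first by rewrite rc.
by rewrite mulSn -addnA ltnNge leq_addr addKn IH.
Qed.

End Flatten.

(** Uniqueness of division with remainder. *)
Lemma eqn_mulD s i j q r : (q < s)%N -> (r < s)%N ->
  (i * s + q == j * s + r)%N = (i == j) && (q == r).
Proof.
move=> qs rs; have s_gt0 : (0 < s)%N by lia.
apply/eqP/andP => [eq_ij|[/eqP-> /eqP->]] //.
have := congr1 (divn^~ s) eq_ij; rewrite !divnMDl // !divn_small // !addn0 => ij.
by move: eq_ij; rewrite ij => /addnI->.
Qed.

Lemma mulD_lt m s i r : (i < m)%N -> (r < s)%N -> (i * s + r < m * s)%N.
Proof.
by move=> im rs; apply: leq_trans (_ : i.+1 * s <= _)%N;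
  rewrite ?leq_mul2r ?im ?orbT // mulSn; lia.
Qed.

Section WriteEntries.
Variables (F : fieldType) (w : seq (value F)) (S p q : nat).
Hypothesis q_lt : (q < S * S)%N.

(** As q is below S^2, copy number i goes to the address with quotient i and remainder q modulo S^2,
    so distinct copies never collide. *)
Lemma write_entries_in j o i r : (r < S * S)%N ->
  write_entries w S p q j o (i * (S * S) + r) =
    if (r == q) && (i < j)%N then load w (p + i) else o (i * (S * S) + r)%N.
Proof.
move=> r_lt; elim: j => [|j IHj]; first by rewrite andbF.
rewrite write_entriesS /set_cell [(q + _)%N]addnC eqn_mulD // IHj andbC.
case: (r == q) => //=.
have [->|ij] := eqVneq i j; first by rewrite ltnSn.
by rewrite ltnS [(i <= j)%N]leq_eqVlt (negbTE ij).
Qed.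

Lemma write_entries_out m o x : (m * (S * S) <= x)%N ->
  write_entries w S p q m o x = o x.
Proof.
move=> mx; suff H j : (j <= m)%N -> write_entries w S p q j o x = o x by apply: H.
elim: j => [|j IHj] jm //; rewrite write_entriesS /set_cell (IHj (ltnW jm)).
by have := mulD_lt jm q_lt; case: eqP => //; lia.
Qed.

End WriteEntries.

(** * Layout of the input word and contents of the output *)

Section AbpWord.
Variables (F : fieldType) (m n : nat) (P : abp F m n.+1).
Local Notation S := n.+1.
Local Notation w := (abp_word P).

Definition abp_edges : seq ('I_S * 'I_S) :=
  [seq e <- enum {: 'I_S * 'I_S} | abp_rel P e.1 e.2].
Local Notation E := (size abp_edges).
Local Notation edge k := (nth (ord0, ord0) abp_edges k).

Definition edge_block (e : 'I_S * 'I_S) : seq (value F) :=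
  Num (val e.1) :: Num (val e.2) ::
  (if abp_edge P e.1 e.2 is Some l then [seq Elt (l i) | i <- enum 'I_m] else [::]).

Lemma abp_wordE :
  w = ([:: Num m; Num S; Num (abp_depth P);
        Num (val (abp_source P)); Num (val (abp_sink P))]
       ++ [seq Num (val i) | i <- enum 'I_m]
       ++ [seq Num (abp_level P v) | v <- enum 'I_S])
      ++ Num E :: flatten [seq edge_block e | e <- abp_edges].
Proof. by rewrite /abp_word -!catA. Qed.

Lemma edge_block_size : all (fun s => size s == m + 2)%N
  [seq edge_block e | e <- abp_edges].
Proof.
rewrite all_map; apply/allP => e; rewrite mem_filter => /andP[+ _].
rewrite /abp_rel /= /edge_block; case: (abp_edge P e.1 e.2) => //= l _.
by rewrite size_map size_enum_ord addn2.
Qed.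

Lemma abp_word_size : size w = edge_pos m S E.
Proof.
rewrite abp_wordE !size_cat size_map size_enum_ord
  size_map size_enum_ord /=.
by rewrite (size_flatten_const edge_block_size) size_map /edge_pos; lia.
Qed.

Lemma load_abp_word_count : load w (5 + (m + S)) = Num E.
Proof.
rewrite abp_wordE /load nth_cat !size_cat size_map size_enum_ord
  size_map size_enum_ord /=.
by rewrite ltnn subnn.
Qed.

Lemma load_abp_word_edge k r : (k < E)%N -> (r < m + 2)%N ->
  load w (edge_pos m S k + r) = nth (Num 0) (edge_block (edge k)) r.
Proof.
move=> kE r_lt; rewrite abp_wordE /load nth_cat !size_cat size_map size_enum_ord
  size_map size_enum_ord.
rewrite ltnNge /edge_pos /= ifN; last by lia.
(* The successor accounts for the cell that holds the number of edges. *)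
rewrite (_ : _ - _ = (k * (m + 2) + r).+1)%N /=; last by lia.
by rewrite nth_flatten_const ?edge_block_size // (nth_map (ord0, ord0)).
Qed.

Lemma load_abp_word_coef k (i : 'I_m) : (k < E)%N ->
  load w (edge_pos m S k + 2 + i) = Elt (abp_mx P i (edge k).1 (edge k).2).
Proof.
move=> kE; rewrite -addnA load_abp_word_edge //; last by have := ltn_ord i; lia.
(* A listed pair is an edge, so it has a label and its coefficients are present. *)
have := mem_nth (ord0, ord0) kE; rewrite mem_filter => /andP[].
rewrite /edge_block /abp_rel mxE; case: (abp_edge P _ _) => //= l _ _.
by rewrite add0n (nth_map i) ?nth_ord_enum // size_enum_ord.
Qed.

Local Notation s := (abp_source P).
Local Notation t := (abp_sink P).

Lemma val_tperm N (x y z : 'I_N) : val (tperm x y z) = swapn x y z.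
Proof.
rewrite /swapn; case: tpermP => [->|->|/eqP zx /eqP zy]; rewrite ?eqxx //.
  by case: eqP.
by rewrite !(inj_eq val_inj) (negbTE zx) (negbTE zy).
Qed.

Lemma relabelE_perm (x : 'I_S) : relabel S s t x = abp_perm P x.
Proof. by rewrite /relabel subn1 permM !val_tperm. Qed.

Local Notation u k := (val (edge k).1).
Local Notation v k := (val (edge k).2).
Local Notation cell k :=
  (edge_cell S s t (fun j => u j) (fun j => v j) k).

Lemma cell_ltn (a b : 'I_S) : (a * S + b < S * S)%N.
Proof. exact: mulD_lt. Qed.

Lemma edge_cellE k :
  cell k = (abp_perm P (edge k).1 * S + abp_perm P (edge k).2)%N.
Proof. by rewrite /edge_cell !relabelE_perm. Qed.

Local Notation written k :=
  (write_edges w m S s t (fun j => u j) (fun j => v j) k).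

(** Since [abp_perm] is injective, the cell of (a, b) is touched only by the edge from a to b;
    otherwise it keeps the zero of the filling. *)
Lemma written_in k (i : 'I_m) (a b : 'I_S) : (k <= E)%N ->
  written k (i * (S * S) + (abp_perm P a * S + abp_perm P b)) =
    Elt (if (a, b) \in take k abp_edges then abp_mx P i a b else 0).
Proof.
elim: k => [|k IHk] kE.
  by rewrite take0 /write_edges /= /fill (mulD_lt (ltn_ord i) (cell_ltn _ _)).
rewrite write_edgesS write_entries_in ?edge_cellE ?cell_ltn // (ltn_ord i) andbT.
rewrite (take_nth (ord0, ord0) kE) mem_rcons in_cons eqn_mulD //.
rewrite !(inj_eq val_inj) !(inj_eq perm_inj) IHk ?(ltnW kE) //.
have -> : ((a, b) == edge k) = (a == (edge k).1) && (b == (edge k).2).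
  by case: (edge k).
by case: andP => // -[/eqP-> /eqP->]; rewrite load_abp_word_coef.
Qed.

Lemma written_out k x : (m * (S * S) <= x)%N -> written k x = Num 0.
Proof.
move=> mx; elim: k => [|k IHk].
  by rewrite /write_edges /= /fill ltnNge mx.
by rewrite write_edgesS write_entries_out ?edge_cellE ?cell_ltn.
Qed.

(** Dividing an address by S^2 and its remainder by S gives the matrix, row and column. Beyond m S^2
    both sides are the default [Num 0]. *)
Lemma written_all : written E =1 load (mxs_word (abp_mx_perm P)).
Proof.
move=> x; rewrite /mxs_word /load.
have size_rows (i : 'I_m) : all (fun xs => size xs == S)
    [seq [seq Elt (abp_mx_perm P i k l) | l <- enum 'I_S] | k <- enum 'I_S].
  by rewrite all_map; apply/allP => k _; rewrite /= size_map size_enum_ord.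
have size_mxs : all (fun xs => size xs == S * S)%N
    [seq [seq Elt (abp_mx_perm P i k l) | k <- enum 'I_S, l <- enum 'I_S]
    | i <- enum 'I_m].
  rewrite all_map; apply/allP => i _.
  by rewrite /= (size_flatten_const (size_rows i)) size_map size_enum_ord.
have [x_lt|x_ge] := ltnP x (m * (S * S)); last first.
  rewrite written_out // nth_default // (size_flatten_const size_mxs).
  by rewrite size_map size_enum_ord.
have i_lt : (x %/ (S * S) < m)%N by rewrite ltn_divLR.
pose r := (x %% (S * S))%N; have r_lt : (r < S * S)%N by rewrite ltn_mod.
have k_lt : (r %/ S < S)%N by rewrite ltn_divLR.
have l_lt : (r %% S < S)%N by rewrite ltn_mod.
pose i := Ordinal i_lt; pose k := Ordinal k_lt; pose l := Ordinal l_lt.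
have -> : x = (i * (S * S) + (k * S + l))%N by rewrite /= -!divn_eq.
rewrite nth_flatten_const ?cell_ltn //.
rewrite (nth_map i) ?size_enum_ord // nth_ord_enum nth_flatten_const //.
rewrite (nth_map k) ?size_enum_ord // nth_ord_enum.
rewrite (nth_map l) ?size_enum_ord // nth_ord_enum.
(* Row and column are images of vertices under the renumbering, as [written_in] expects. *)
rewrite -[k in LHS](permKV (abp_perm P)) -[l in LHS](permKV (abp_perm P)).
rewrite written_in // take_size mem_filter mem_enum andbT /abp_rel [in RHS]mxE mxE.
by case: (abp_edge P _ _).
Qed.

End AbpWord.

(** * The running time *)

Section AbpTime.
Variables (F : fieldType) (esize : F -> nat) (m n : nat) (P : abp F m n.+1).
Local Notation w := (abp_word P).
Local Notation W := (wsize esize w).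
(** [W ^ 3] dominates (m + 1) S^2 and the input length, the 2 gives room for strict bounds, and the
    size of the field element 0 enters because the program writes it. *)
Local Notation L := ((2 + vsize esize (Elt (0%R : F))) * W ^ 3)%N.

(** Each cell has size at least 1, so W is at least the length of the word. *)
Lemma abp_word_size_le : (6 + (m + n.+1) + size (abp_edges P) * (m + 2) <= W)%N.
Proof.
have := abp_word_size P; rewrite /edge_pos => <-.
rewrite /wsize; elim: (abp_word P) => //= v r IHr.
by rewrite big_cons; have := vsize_gt0 esize v; lia.
Qed.

Lemma vsize_load_le i : (vsize esize (load w i) <= W)%N.
Proof.
have W_gt0 : (0 < W)%N by have := abp_word_size_le; lia.
rewrite /wsize /load in W_gt0 *.
have [i_lt|i_ge] := ltnP i (size w); last first.
  by rewrite nth_default // (leq_trans _ W_gt0) //= trunc_log0.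
by rewrite (big_nth (Num 0)) big_mkord (bigD1 (Ordinal i_lt)) //= leq_addr.
Qed.

(** Independent of the branching program: it adds up the coefficients in [abp_cmd_weight] of 1, m
    S^2 + 1, E + 1 and (m + 1)(E + 1), each at most [W ^ 3]. *)
Definition cmd_const : nat :=
  let: K := ((weight esize (EGet 2 (ECst (@Num F 3))) ^ 2
              + cweight esize (entry_body F)).+1)%N in
  (cweight esize (fill_setup F) + cweight esize (edges_setup F)
   + (weight esize (EGet 2 (ECst (@Num F 0))) ^ 2
      + cweight esize (fill_body F))
   + (weight esize (EGet 2 (ECst (@Num F 0))) ^ 2
      + cweight esize (edge_setup F) + K) + 6)%N.

Lemma abp_cmd_time : exists p q,
  runs esize (init w) (abp_cmd F)
    (cmd_const * W ^ 3 * L)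
    (state w (load (mxs_word (abp_mx_perm P))) 0 p q 0).
Proof.
have W_ge := abp_word_size_le.
set E := size (abp_edges P) in W_ge.
have E_lt : (E < W)%N by nia.
have mS : (m + n.+1 < W)%N by lia.
have X1 : (W <= W ^ 3)%N by rewrite -{1}(expn1 W) leq_pexp2l //; lia.
have SS : (n.+1 * n.+1 <= W * W)%N by apply: leq_mul; lia.
have mSS : (m.+1 * (n.+1 * n.+1) <= W ^ 3)%N.
  by rewrite expnS -mulnn; apply: leq_mul => //; lia.
have mE : (m.+1 * E.+1 <= W ^ 3)%N.
  rewrite expnS -mulnn; apply: leq_mul; first by lia.
  by apply: (leq_trans E_lt); rewrite leq_pmulr //; lia.
pose e j := nth (ord0, ord0) (abp_edges P) j.
have cell_lt j : (edge_cell n.+1 (abp_source P) (abp_sink P)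
    (fun i => val (e i).1) (fun i => val (e i).2) j < n.+1 * n.+1)%N.
  by rewrite edge_cellE cell_ltn.
have pos_E : (edge_pos m n.+1 E <= W)%N by rewrite /edge_pos.
have L_ge : (2 * W ^ 3 <= L)%N by rewrite leq_mul2r leq_addr orbT.
have word_u k : (k < E)%N -> load w (edge_pos m n.+1 k) = Num (val (e k).1).
  by move=> kE; rewrite -[edge_pos _ _ _]addn0 load_abp_word_edge //; lia.
have word_v k : (k < E)%N -> load w (edge_pos m n.+1 k + 1) = Num (val (e k).2).
  by move=> kE; rewrite load_abp_word_edge //; lia.
have [|||||||p [q [T exT T_le]]] := runs_abp_cmd (esize := esize) (L := L) (w := w)
  (m := m) (S := n.+1) (s := abp_source P) (t := abp_sink P) (E := E)
  erefl erefl erefl erefl (load_abp_word_count P) word_u word_v.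
- move=> i; apply: (leq_trans (vsize_load_le i)).
  by apply: (leq_trans X1); rewrite leq_pmull.
- by apply: (leq_trans (leq_addl 2 _)); rewrite leq_pmulr //; lia.
- by lia.
- by lia.
- by move: mSS; rewrite mulSn; lia.
- by lia.
- by move=> k _; have := cell_lt k; move: mSS; rewrite mulSn; lia.
exists p, q, T; first by rewrite -(functional_extensionality _ _ (written_all P)).
apply: (leq_trans T_le); rewrite leq_mul2r; apply/orP; right.
rewrite /abp_cmd_weight /edge_weight /cmd_const.
move: (cweight esize (fill_setup F)) (cweight esize (edges_setup F))
  (cweight esize (fill_body F)) (cweight esize (edge_setup F))
  (cweight esize (entry_body F)) (weight esize (EGet 2 (ECst (@Num F 0))) ^ 2)%N
  (weight esize (EGet 2 (ECst (@Num F 3))) ^ 2)%N => c1 c2 c3 c4 c5 w0 w3.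
have N_le : ((m * (n.+1 * n.+1)).+1 <= W ^ 3)%N by move: mSS; rewrite mulSn; lia.
have E_le : (E.+1 <= W ^ 3)%N by lia.
move: (W ^ 3)%N N_le E_le mE => X; move: (m * _).+1 => N N_le E_le mE_le.
(* The cost splits into four groups, each at most X times a constant; the 6 in [cmd_const] is 1 + 2
   + 3 from the successors. *)
have := leq_mul N_le (leqnn (w0 + c3).+1).
have := leq_mul E_le (leqnn (w0 + c4 + 2)).
have := leq_mul mE_le (leqnn (w3 + c5).+1).
have : (c1 + c2 + 3 <= X * (c1 + c2 + 3))%N by rewrite leq_pmull //; lia.
clear; lia.
Qed.

End AbpTime.

Lemma polytime_abp_mx_perm (F : fieldType) (esize : F -> nat) :
  polytime esize
    (fun P : {m : nat & {n : nat & abp F m n.+1}} => abp_word (tagged (tagged P)))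
    (fun P : {m : nat & {n : nat & abp F m n.+1}} =>
       mxs_word (abp_mx_perm (tagged (tagged P)))).
Proof.
(* The exponent is 3 + 3: one [W ^ 3] from the numbers of passes, one from the bound L on sizes. *)
exists (abp_cmd F), (cmd_const esize * (2 + vsize esize (Elt 0%R)))%N, 6%N.
case=> m [n P]; have [p [q [t ex_t t_le]]] := abp_cmd_time esize P.
exists t, (state (abp_word P) (load (mxs_word (abp_mx_perm P))) 0 p q 0).
split=> //; apply: (leq_trans t_le); apply: (leq_trans _ (leq_addr _ _)).
by rewrite mulnACA -expnD.
Qed.

(* The number S of vertices is n.+1. *)
Theorem theorem3p2 (F : fieldType) :
  exists A : forall m n : nat, abp F m n.+1 -> 'I_m -> 'M[F]_n.+1,
    (forall (d m n : nat) (g : ncpoly F m) (P : abp F m n.+1),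
        nchomog d g -> g = abp_poly P ->
        forall f : ncpoly F m, nchomog d f ->
          hadamard f g = ncsubst (mxvar (A m n P)) f ord0 ord_max)
    /\ (forall esize : F -> nat,
        polytime esize
          (fun P : {m : nat & {n : nat & abp F m n.+1}} =>
             abp_word (tagged (tagged P)))
          (fun P : {m : nat & {n : nat & abp F m n.+1}} =>
             mxs_word (A (tag P) (tag (tagged P)) (tagged (tagged P))))).
Proof.
exists (fun m n P => abp_mx_perm P); split; last exact: polytime_abp_mx_perm.
by move=> d m n g P _ -> f _; apply: hadamard_abp_poly.
Qed.
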